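(* Let $f\in L^1(\mathbb{T})$, and let $K$ be a closed subset of $\mathbb{T}$ such that $K\subset C_f$. Then $\sigma_n(x,f)$ converges to $f(x)$ uniformly with respect to $x\in K$ as $n\to\infty$.
   Context: $\mathbb{T}$ is the additive quotient group $\mathbb{R}/2\pi\mathbb{Z}$; functions on $\mathbb{T}$ are identified with $2\pi$-periodic functions. $L^1(\mathbb{T})$ is the space of complex-valued Lebesgue-integrable functions on $\mathbb{T}$; here $f$ is regarded as an actual function defined at every point of $\mathbb{T}$. $C_f$ is the set of all points of $\mathbb{T}$ at which $f:\mathbb{T}\to\mathbb{C}$ is continuous. The Fourier coefficients are $\widehat{f}(k):=\frac{1}{2\pi}\int_{-\pi}^{\pi}f(s)e^{-iks}\,ds$, $k\in\mathbb{Z}$; $S_n(x,f):=\sum_{|k|\leq n}\widehat{f}(k)e^{ikx}$; and $\sigma_n(x,f):=\frac{S_0(x,f)+S_1(x,f)+\dots+S_n(x,f)}{n+1}$ for integers $n\geq0$. *)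

(* Defs.v *)
From HB Require Import structures.
From mathcomp Require Import all_boot all_order all_algebra generic_quotient.
From mathcomp Require Import all_classical all_reals all_analysis.
From mathcomp Require Import complex.

Set Implicit Arguments.
Unset Strict Implicit.
Unset Printing Implicit Defensive.

Import Order.TTheory GRing.Theory Num.Theory numFieldNormedType.Exports.
Import Quotient.Exports.

Local Open Scope classical_set_scope.
Local Open Scope ring_scope.
Local Open Scope complex_scope.
Local Open Scope quotient_scope.

Section Circle.
Context (R : realType).

Definition twopiZ : {pred R} :=
  fun x => `[< exists k : int, x = k%:~R * (pi *+ 2) >].

Lemma twopiZ_zmod_closed : zmod_closed twopiZ.
Proof.
split; first by apply/asboolP; exists 0; rewrite mul0r.
move=> x y /asboolP[k ->] /asboolP[l ->]; apply/asboolP; exists (k - l).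
by rewrite intrB mulrBl.
Qed.

HB.instance Definition _ := GRing.isZmodClosed.Build R twopiZ twopiZ_zmod_closed.

Definition circle : Type := quotient_topology (Quotient.quot twopiZ).

HB.instance Definition _ :=
  Topological.copy circle (quotient_topology (Quotient.quot twopiZ)).
HB.instance Definition _ :=
  Quotient.copy circle (quotient_topology (Quotient.quot twopiZ)).

Lemma circle_eqP (s t : R) :
  (\pi_circle s = \pi_circle t) <-> exists k : int, s - t = k%:~R * (pi *+ 2).
Proof.
have -> : (\pi_circle s = \pi_circle t) <-> s - t \in twopiZ.
  rewrite (Quotient.idealrBE (twopiZ : zmodClosed R)).
  by split=> [h|/eqP//]; apply/eqP.
by split=> [/asboolP|h] //; apply/asboolP.
Qed.

Definition expi (t : R) : R[i] := cos t +i* sin t.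

(* The character e^{ikx}; by [echarE] the choice of representative is
   irrelevant. *)
Definition echar (k : int) (x : circle) : R[i] := expi (k%:~R * repr x).

Lemma expi_period (t : R) (k : int) : expi (t + k%:~R * (pi *+ 2)) = expi t.
Proof.
have hn (u : R) (n : nat) : expi (u + n%:R * (pi *+ 2)) = expi u.
  rewrite mulr_natl /expi; congr (_ +i* _).
    exact: (periodicn (@cosD2pi R)).
  exact: (periodicn (@sinD2pi R)).
case: k => n; first exact: hn.
by rewrite NegzE mulrNz mulNr -[in RHS](subrK (n.+1%:R * (pi *+ 2)) t) hn.
Qed.

Lemma echarE (k : int) (t : R) : echar k (\pi_circle t) = expi (k%:~R * t).
Proof.
have /circle_eqP[l hl] : \pi_circle (repr (\pi_circle t)) = \pi_circle t.
  by rewrite reprK.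
rewrite /echar -(expi_period (k%:~R * t) (k * l)); congr expi.
by rewrite intrM -mulrA -hl mulrBr addrC subrK.
Qed.

(* The completed measure is used so that "measurable" means Lebesgue
   measurable, and not just Borel measurable. *)
Definition cintegrable (g : R -> R[i]) : Prop :=
  (@completed_lebesgue_measure R).-integrable `[- pi, pi]
     (fun s => (complex.Re (g s))%:E)
  /\ (@completed_lebesgue_measure R).-integrable `[- pi, pi]
     (fun s => (complex.Im (g s))%:E).

Definition cintegral (g : R -> R[i]) : R[i] :=
  (\int[@completed_lebesgue_measure R]_(s in `[- pi, pi]) complex.Re (g s))
  +i*
  (\int[@completed_lebesgue_measure R]_(s in `[- pi, pi]) complex.Im (g s)).

(* R[i]^o is R[i] seen as a normed space over itself; this is the type that
   carries the topology given by the complex modulus. *)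
Implicit Types f : circle -> R[i]^o.

(* Elements of L1 are functions, not classes modulo a.e. equality. *)
Definition L1 f : Prop := cintegrable (f \o \pi_circle).

Definition continuity_points f : set circle := [set x | {for x, continuous f}].

Definition fourier_coef f (k : int) : R[i] :=
  ((pi *+ 2)^-1)%:C *
  cintegral (fun s => f (\pi_circle s) * expi (- (k%:~R * s))).

(* The index j - n runs over the integers k with |k| <= n. *)
Definition fourier_sum f (n : nat) (x : circle) : R[i] :=
  \sum_(j < n.*2.+1) fourier_coef f (j%:Z - n%:Z) * echar (j%:Z - n%:Z) x.

Definition fejer_mean f (n : nat) : circle -> R[i]^o :=
  fun x => (\sum_(m < n.+1) fourier_sum f m x) / n.+1%:R.

End Circle.

(* Main.v *)
Require Import Defs.
From mathcomp Require Import all_boot all_order all_algebra.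
From mathcomp Require Import all_classical all_reals all_analysis.
From mathcomp Require Import measurable_realfun complex zify ring lra.
Import Order.TTheory GRing.Theory Num.Theory.
Import numFieldNormedType.Exports.
Local Open Scope classical_set_scope.
Local Open Scope ring_scope.

(** The Fejer means are convolutions: on the line,
    sigma_n(x, f) = (2 pi)^-1 int_[-pi, pi] f(s) F_n(x - s) ds
    with F_n >= 0, (2 pi)^-1 int F_n(x - s) ds = 1 and
    (1 - cos t) (n + 1) F_n(t) = 1 - cos((n + 1) t).  Measuring distances on the
    circle by 1 - cos(x - s), one has for every d > 0 the pointwise bound
    |f(s) - f(x)| F_n(x - s)
       <= e F_n(x - s) + (|f(s)| + |f(x)|) 2 / ((n + 1) d),
    where e bounds |f(s) - f(x)| for 1 - cos(x - s) < d.  Compactness of K makes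
    d uniform in x and f bounded on K, and integrating in s concludes.  The
    real and imaginary parts of f are handled separately. *)

(** * Dirichlet and Fejer kernels as real trigonometric sums *)

Section Fejer_kernel.
Context {R : realType}.
Set Implicit Arguments.
Unset Strict Implicit.
Unset Printing Implicit Defensive.
Implicit Types (t : R) (n m : nat).

(** Real form of the sum of [e^{ikt}] over [|k| <= n], whose sines cancel by [sum_sin_eq0]; the
    index shift is that of [fourier_sum]. *)
Definition dirichlet_kernel n t : R :=
  \sum_(j < n.*2.+1) cos ((j%:Z - n%:Z)%:~R * t).

Definition fejer_kernel n t : R :=
  (\sum_(m < n.+1) dirichlet_kernel m t) / n.+1%:R.

(** Induction step for symmetric sums: only the two extreme frequencies are new. An arbitrary [h]
    covers both sines and cosines. *)
Lemma sum_centeredS (V : zmodType) (h : int -> V) n :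
  \sum_(j < n.+1.*2.+1) h (j%:Z - n.+1%:Z) =
  h (- n.+1%:Z) + \sum_(j < n.*2.+1) h (j%:Z - n%:Z) + h n.+1%:Z.
Proof.
rewrite doubleS big_ord_recr big_ord_recl /= sub0r.
congr (_ + _ + h _); last lia.
by apply: eq_bigr => j _; congr h; rewrite /bump /=; lia.
Qed.

Lemma sum_sin_eq0 n t : \sum_(j < n.*2.+1) sin ((j%:Z - n%:Z)%:~R * t) = 0 :> R.
Proof.
elim: n => [|n IH]; first by rewrite big_ord1 subrr mul0r sin0.
rewrite (@sum_centeredS _ (fun k => sin (k%:~R * t))) IH addr0.
by rewrite mulrNz mulNr sinN addNr.
Qed.

Lemma dirichlet_kernelS n t :
  dirichlet_kernel n.+1 t = dirichlet_kernel n t + cos (n.+1%:R * t) *+ 2.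
Proof.
rewrite /dirichlet_kernel (@sum_centeredS _ (fun k => cos (k%:~R * t))).
by rewrite mulrNz mulNr cosN mulr2n -pmulrn; ring.
Qed.

(* Stated without division so that it also holds when [cos t = 1]. *)
Lemma dirichlet_kernel_closed n t :
  (1 - cos t) * dirichlet_kernel n t = cos (n%:R * t) - cos (n.+1%:R * t).
Proof.
elim: n => [|n IH].
  by rewrite /dirichlet_kernel big_ord1 subrr !mul0r cos0 mulr1 mul1r.
rewrite dirichlet_kernelS mulrDr IH.
have -> : n.+2%:R * t = n.+1%:R * t + t by rewrite -[in LHS]natr1; ring.
have -> : n%:R * t = n.+1%:R * t - t by rewrite -natr1; ring.
by rewrite cosB cosD; ring.
Qed.

(** The closed forms of the Dirichlet kernels telescope over [m]. *)
Lemma fejer_kernel_closed n t :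
  (1 - cos t) * fejer_kernel n t = (1 - cos (n.+1%:R * t)) / n.+1%:R.
Proof.
rewrite /fejer_kernel mulrA mulr_sumr; congr (_ / _).
under eq_bigr do rewrite dirichlet_kernel_closed.
rewrite -(big_mkord xpredT (fun m => cos (m%:R * t) - cos (m.+1%:R * t))).
under eq_bigr do rewrite -opprB.
by rewrite sumrN telescope_sumr// opprB mul0r cos0.
Qed.

Lemma cos_muln_eq1 n t : cos t = 1 -> cos (n%:R * t) = 1.
Proof.
move=> c1; have s0 : sin t = 0 by apply: cos1sin0; rewrite c1 normr1.
elim: n => [|n IH]; first by rewrite mul0r cos0.
by rewrite -natr1 mulrDl mul1r cosD s0 IH c1; ring.
Qed.

Lemma fejer_kernel_ge0 n t : 0 <= fejer_kernel n t.
Proof.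
(* At [cos t = 1] the closed form reads [0 = 0]; there every cosine in the sum equals 1 instead. *)
have [c1|c1] := eqVneq (cos t) 1.
  apply: divr_ge0 => //; apply: sumr_ge0 => m _; elim: (nat_of_ord m) => [|k IH].
    by rewrite /dirichlet_kernel big_ord1 subrr mul0r cos0.
  by rewrite dirichlet_kernelS cos_muln_eq1// addr_ge0.
have c0 : 0 < 1 - cos t by rewrite subr_gt0 lt_neqAle c1 cos_le1.
rewrite -(pmulr_rge0 _ c0) fejer_kernel_closed divr_ge0// subr_ge0 cos_le1.
Qed.

(** In the closed form, [1 - cos t] is at least [d] and the numerator on the right is at most 2. *)
Lemma fejer_kernel_tail n t d : 0 < d -> d <= 1 - cos t ->
  fejer_kernel n t <= 2 / (d * n.+1%:R).
Proof.
move=> d0 dt; rewrite invfM mulrCA mulrC ler_pdivlMr//.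
rewrite mulrC; apply: (@le_trans _ _ ((1 - cos t) * fejer_kernel n t)).
  by rewrite ler_wpM2r// fejer_kernel_ge0.
rewrite fejer_kernel_closed ler_wpM2r ?invr_ge0//.
by have := cos_geN1 (n.+1%:R * t); lra.
Qed.

Lemma continuous_dirichlet_kernel n : continuous (dirichlet_kernel n).
Proof.
apply: continuous_big => [|j _ t]; first exact: add_continuous.
apply: continuous_comp; last exact: continuous_cos.
by apply: cvgM; [exact: cvg_cst|exact: cvg_id].
Qed.

Lemma continuous_fejer_kernel n : continuous (fejer_kernel n).
Proof.
move=> t; apply: cvgM; last exact: cvg_cst.
apply: cvg_big => [|m _]; first exact: add_continuous.
exact: continuous_dirichlet_kernel.
Qed.

End Fejer_kernel.

(** * Integration over one period for the completed Lebesgue measure *)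

Section Integration.
Context {R : realType}.
Set Implicit Arguments.
Unset Strict Implicit.
Unset Printing Implicit Defensive.
Local Notation mu := (@completed_lebesgue_measure R).
Local Notation cR := (caratheodory_type (wlength (@idfun R))^*%mu).
Local Notation cycle := (`[- pi, pi]%classic : set R).
Implicit Types (D : set R) (u v h : R -> R).

Lemma measurable_completed D : measurable D -> measurable (D : set cR).
Proof. by move=> mA; apply: sub_caratheodory. Qed.

(* As a set function, [lebesgue_measure] is by conversion the pushforward of the
   completed measure under the identity. *)
Lemma integral_completed D (h : R -> \bar R) :
  measurable D -> measurable_fun [set: R] h -> mu.-integrable D h ->
  (\int[mu]_(x in D) h x = \int[lebesgue_measure]_(x in D) h x)%E.
Proof.
move=> mD mh ih.
pose phi : cR -> measurableTypeR R := idfun.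
have mphi : measurable_fun [set: cR] phi.
  by move=> _ Y mY; rewrite setTI; apply: measurable_completed.
have := @integral_pushforward _ _ cR (measurableTypeR R) R phi mphi mu D h mh ih mD.
by move=> /esym.
Qed.

Lemma continuous_measurable_completed D h :
  measurable D -> continuous h -> measurable_fun (D : set cR) h.
Proof.
move=> mD ch _ Y mY; apply: measurable_completed; apply: measurableI => //.
by rewrite -[X in measurable X]setTI; apply: (continuous_measurable_fun ch).
Qed.

Lemma measurable_cycle : measurable (cycle : set cR).
Proof. by apply: measurable_completed; apply: measurable_itv. Qed.

Lemma completed_measure_cycle : mu cycle = (pi *+ 2)%:E.
Proof.
rewrite -[LHS]/(@lebesgue_measure R cycle) lebesgue_measure_itv /=.
by rewrite lte_fin gtrN ?pi_gt0// -EFinB opprK mulr2n.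
Qed.

Lemma continuous_bounded_cycle h : continuous h -> [bounded h x | x in cycle].
Proof.
move=> ch; have /compact_bounded[M [Mr hM]] : compact (h @` cycle).
  apply: continuous_compact; last exact: segment_compact.
  exact: continuous_subspaceT.
by exists M; split=> // N MN s cs; apply: (hM _ MN); exists s.
Qed.

(** A continuous factor is bounded on the compact period, so it preserves integrability. *)
Lemma integrable_mul_continuous u h : continuous h ->
  mu.-integrable cycle (EFin \o u) ->
  mu.-integrable cycle (EFin \o (fun s => u s * h s)).
Proof.
move=> ch iu.
have -> : EFin \o (fun s => u s * h s) = ((EFin \o u) \* (EFin \o h))%E by [].
apply: integrableMl => //; first exact: measurable_cycle.
  by apply: continuous_measurable_completed => //; apply: measurable_itv.
exact: continuous_bounded_cycle.
Qed.

Lemma integrable_continuous h : continuous h ->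
  mu.-integrable cycle (EFin \o h).
Proof.
move=> ch; apply: measurable_bounded_integrable; first exact: measurable_cycle.
- by rewrite -[X in (X < _)%E]/(mu cycle) completed_measure_cycle ltry.
- by apply: continuous_measurable_completed => //; apply: measurable_itv.
- exact: continuous_bounded_cycle.
Qed.

Lemma integrable_EFinD d (T : measurableType d) (nu : {measure set T -> \bar R})
    (D : set T) (g h : T -> R) : measurable D ->
  nu.-integrable D (EFin \o g) -> nu.-integrable D (EFin \o h) ->
  nu.-integrable D (EFin \o (fun x => g x + h x)).
Proof. by move=> mD ig ih; exact: (integrableD mD ig ih). Qed.

Lemma integrable_EFinB d (T : measurableType d) (nu : {measure set T -> \bar R})
    (D : set T) (g h : T -> R) : measurable D ->
  nu.-integrable D (EFin \o g) -> nu.-integrable D (EFin \o h) ->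
  nu.-integrable D (EFin \o (fun x => g x - h x)).
Proof. by move=> mD ig ih; exact: (integrableB mD ig ih). Qed.

Lemma Rintegral_sum d (T : measurableType d) (nu : {measure set T -> \bar R})
    (D : set T) (I : Type) (s : seq I) (g : I -> T -> R) :
  measurable D -> (forall i, nu.-integrable D (EFin \o g i)) ->
  \int[nu]_(x in D) (\sum_(i <- s) g i x) = \sum_(i <- s) \int[nu]_(x in D) g i x.
Proof.
move=> mD ig; rewrite /Rintegral.
under eq_integral do rewrite -sumEFin.
rewrite (integral_sum mD ig) sum_fine// => i _.
by apply: integrable_fin_num => //; exact: ig.
Qed.

Lemma continuous_cos_affine (k x : R) : continuous (fun s => cos (k * (x - s))).
Proof.
move=> s; apply: continuous_comp; last exact: continuous_cos.
by apply: cvgM; [exact: cvg_cst|apply: cvgB; [exact: cvg_cst|exact: cvg_id]].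
Qed.

Lemma Rintegral_cos (k : int) x : k != 0 ->
  \int[mu]_(s in cycle) cos (k%:~R * (x - s)) = 0.
Proof.
move=> k0; have kR0 : k%:~R != 0 :> R by rewrite intr_eq0.
(* The fundamental theorem of calculus applied below concerns [lebesgue_measure], hence the change
   of measure. *)
rewrite /Rintegral integral_completed; first last.
- exact/integrable_continuous/continuous_cos_affine.
- apply: measurableT_comp => //; apply: continuous_measurable_fun.
  exact: continuous_cos_affine.
- exact: measurable_itv.
pose A : R -> R := fun s => k%:~R * (x - s).
pose F : R -> R := fun s => - ((k%:~R)^-1 * sin (A s)).
have dA (s : R) : is_derive s 1 A (- k%:~R).
  have -> : A = k%:~R \*: (cst x - id) by apply/funext => t.
  by apply: is_derive_eq; rewrite /GRing.scale /= sub0r mulrN mulr1.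
have dF (s : R) : is_derive s 1 F (cos (A s)).
  have -> : F = - ((k%:~R)^-1 \*: (sin \o A)) by apply/funext => t.
  by apply: is_derive_eq; rewrite /GRing.scale /=; field.
have cF : continuous F.
  move=> s; apply: differentiable_continuous; apply/derivable1_diffP.
  exact: ex_derive.
rewrite (@continuous_FTC2 _ _ F); last 4 first.
- by rewrite gtrN ?pi_gt0.
- exact/continuous_subspaceT/continuous_cos_affine.
- split; first by move=> s _; exact: ex_derive.
  + exact/cvg_at_right_filter/cF.
  + exact/cvg_at_left_filter/cF.
- by move=> s _; rewrite derive1E (@derive_val _ _ _ _ _ _ _ (dF s)).
rewrite -EFinB /= /F -opprD -mulrBr; apply/eqP; rewrite oppr_eq0 mulf_eq0.
apply/orP; right; rewrite subr_eq0.
(* The arguments at the two endpoints differ by [k] full periods, so the antiderivative agrees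
   there. *)
have -> : A (- pi) = A pi + k%:~R * (pi *+ 2) by rewrite /A mulr2n; ring.
by have [_ ->] := expi_period (A pi) k.
Qed.

Lemma Rintegral_dirichlet_kernel n x :
  \int[mu]_(s in cycle) dirichlet_kernel n (x - s) = pi *+ 2.
Proof.
rewrite Rintegral_sum; last 2 first.
- exact: measurable_cycle.
- by move=> j; exact/integrable_continuous/continuous_cos_affine.
(* The index [j = n] is frequency 0, the only term with nonzero integral. *)
have jn : (n < n.*2.+1)%N by rewrite ltnS -addnn leq_addr.
rewrite (bigD1 (Ordinal jn)) //= subrr big1 => [|j jn0]; last first.
  apply: Rintegral_cos; apply: contra jn0; rewrite subr_eq0 -val_eqE /=.
  by move/eqP => [->].
rewrite addr0; under eq_Rintegral do rewrite mul0r cos0.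
rewrite Rintegral_cst ?mul1r; last exact: measurable_cycle.
exact: (congr1 fine completed_measure_cycle).
Qed.

Lemma continuous_comp_subl h x : continuous h -> continuous (fun s => h (x - s)).
Proof.
move=> ch s; apply: continuous_comp; last exact: ch.
by apply: cvgB; [exact: cvg_cst|exact: cvg_id].
Qed.

Lemma Rintegral_fejer_kernel n x :
  \int[mu]_(s in cycle) fejer_kernel n (x - s) = pi *+ 2.
Proof.
rewrite RintegralZr; last 2 first.
- exact: measurable_cycle.
- apply: integrable_continuous => s.
  apply: cvg_big => [|m _]; first exact: add_continuous.
  exact/continuous_comp_subl/continuous_dirichlet_kernel.
rewrite Rintegral_sum; last 2 first.
- exact: measurable_cycle.
- move=> m; apply: integrable_continuous.
  exact/continuous_comp_subl/continuous_dirichlet_kernel.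
under eq_bigr do rewrite Rintegral_dirichlet_kernel.
by rewrite sumr_const card_ord -[X in X / _]mulr_natr mulfK.
Qed.

End Integration.

(** * Uniform convergence of real Fejer means on the line *)

Section Real_fejer_mean.
Context {R : realType}.
Set Implicit Arguments.
Unset Strict Implicit.
Unset Printing Implicit Defensive.
Local Notation mu := (@completed_lebesgue_measure R).
Local Notation cycle := (`[- pi, pi]%classic : set R).
Implicit Types (A : set R) (u : R -> R) (n : nat) (x d e : R).

Definition real_fejer_mean u n x : R :=
  (pi *+ 2)^-1 * \int[mu]_(s in cycle) (u s * fejer_kernel n (x - s)).

(** The kernel has mean 1, so the difference is a mean of [u s - c] weighted by it; near points cost
    [e], far ones the tail bound. The right-hand side does not involve [x], which gives
    uniformity. *)
Lemma real_fejer_mean_le u n x c e d (M : R) :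
  mu.-integrable cycle (EFin \o u) -> 0 < d -> `|c| <= M -> 0 <= e ->
  (forall s, s \in cycle -> 1 - cos (x - s) < d -> `|u s - c| <= e) ->
  `|real_fejer_mean u n x - c| <=
  e + ((pi *+ 2)^-1 * \int[mu]_(s in cycle) `|u s| + M) * (2 / (d * n.+1%:R)).
Proof.
move=> iu d0 cM e0 ue; have pi2 : 0 < (pi *+ 2 : R) by rewrite mulrn_wgt0 ?pi_gt0.
have mI := @measurable_cycle R.
set F := fun s => fejer_kernel n (x - s).
have cF : continuous F by exact/continuous_comp_subl/continuous_fejer_kernel.
have F0 s : 0 <= F s by exact: fejer_kernel_ge0.
set k := 2 / _; have k0 : 0 <= k by rewrite divr_ge0// mulr_ge0// ltW.
have iF := integrable_continuous cF.
have iuF := integrable_mul_continuous cF iu.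
have iZ (r : R) h : mu.-integrable cycle (EFin \o h) ->
    mu.-integrable cycle (EFin \o (fun s => h s * r)).
  by move=> ih; apply: integrable_mul_continuous => // s; exact: cvg_cst.
have icF r : mu.-integrable cycle (EFin \o (fun s => r * F s)).
  by apply: integrable_continuous => s; apply: cvgM; [exact: cvg_cst|exact: cF].
have iMk : mu.-integrable cycle (EFin \o (fun=> M * k)).
  by apply: integrable_continuous => s; exact: cvg_cst.
have icompl : mu.-integrable cycle (EFin \o (fun s => u s * F s - c * F s)).
  exact: integrable_EFinB.
(* The constant [c] is absorbed as the mean of [c * F s]. *)
have -> : real_fejer_mean u n x - c =
    (pi *+ 2)^-1 * \int[mu]_(s in cycle) (u s * F s - c * F s).
  rewrite RintegralB// RintegralZl// Rintegral_fejer_kernel mulrBr; congr (_ - _).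
  by rewrite mulrC mulfK// gt_eqF.
have iau : mu.-integrable cycle (EFin \o (fun s => `|u s|)).
  exact: integrable_norm.
have itail : mu.-integrable cycle (EFin \o (fun s => `|u s| * k + M * k)).
  by apply: integrable_EFinD => //; exact: iZ.
have ibound : mu.-integrable cycle
    (EFin \o (fun s => e * F s + (`|u s| * k + M * k))).
  exact: integrable_EFinD.
rewrite normrM gtr0_norm ?invr_gt0// ler_pdivrMl//.
apply: (le_trans (le_normr_Rintegral mI icompl)).
apply: (@le_trans _ _ (\int[mu]_(s in cycle) (e * F s + (`|u s| * k + M * k)))).
  apply: le_Rintegral => //; first exact: integrable_norm.
  move=> s sI; rewrite -mulrBl normrM (ger0_norm (F0 s)).
  (* Near [x] the tail terms are dropped, far from [x] the term [e * F s]; both are nonnegative. *)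
  have [ds|ds] := ltP (1 - cos (x - s)) d.
    apply: (@le_trans _ _ (e * F s)).
      by apply: ler_wpM2r => //; apply: ue => //; rewrite inE.
    by rewrite lerDl addr_ge0// mulr_ge0// (le_trans _ cM).
  have Fk : F s <= k by exact: fejer_kernel_tail.
  apply: (@le_trans _ _ ((`|u s| + M) * k)); last by rewrite mulrDl lerDr mulr_ge0.
  apply: ler_pM => //; apply: (le_trans (ler_normB _ _)); exact: lerD.
rewrite RintegralD// RintegralD//; last exact: iZ.
rewrite RintegralZl// Rintegral_fejer_kernel.
rewrite (RintegralZr k mI iau).
rewrite Rintegral_cst// -[fine _]/(fine (mu cycle)) completed_measure_cycle /=.
set J := Rintegral _ _ _; rewrite le_eqVlt; apply/orP; left; apply/eqP.
(* Generalizing makes the period an atom for [field]. *)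
by move: pi2; generalize (pi *+ 2 : R) => p p0; field; rewrite gt_eqF.
Qed.

(** A Heine-Cantor argument in which [s] ranges over the whole line and only [x] over [A]: [u] is
    continuous at the points of [A], as a function on the line. *)
Lemma compact_uniform_modulus A u e : compact A ->
  {in A, continuous u} -> 0 < e ->
  exists2 d, 0 < d & forall x s, A x -> `|x - s| < d -> `|u s - u x| < e.
Proof.
move=> /compact_near_coveringP cA cu e0.
pose P d x := forall s, `|x - s| < d -> `|u s - u x| < e.
have : \forall d \near 0^'+, A `<=` P d.
  apply: cA => x Ax.
  have /cvgrPdist_lt/(_ (e / 2))[|r /= r0 hr] : {for x, continuous u}.
  - by apply: cu; rewrite inE.
  - by rewrite divr_gt0.
  (* With half radii both [y] and [s] lie within [r] of [x], and each value of [u] is within [e / 2]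
     of [u x]. *)
  exists (ball x (r / 2), [set d | d < r / 2]) => [/=|[y d] /= [xy dr] s ys].
    split; first by apply: nbhsx_ballx; rewrite divr_gt0.
    by apply: nbhs_right_lt; rewrite divr_gt0.
  have h1 := hr y; have h2 := hr s.
  rewrite /ball /= in xy h1 h2.
  apply: (le_lt_trans (ler_distD (u x) _ _)); rewrite [ltRHS]splitr.
  apply: ltrD; [rewrite distrC; apply: h2|apply: h1].
    apply: (le_lt_trans (ler_distD y _ _)); rewrite [ltRHS]splitr.
    by rewrite ltrD// (lt_trans ys).
  by apply: (lt_trans xy); rewrite gtr_pMr// invf_lt1// ltr1n.
move=> [r /= r0 hr]; exists (r / 2); first by rewrite divr_gt0.
move=> x s Ax; apply: (hr (r / 2) _ _ x Ax s).
  by rewrite /= sub0r normrN gtr0_norm ?divr_gt0// gtr_pMr// invf_lt1// ltr1n.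
by rewrite divr_gt0.
Qed.

Lemma compact_continuous_bounded A u : compact A -> {in A, continuous u} ->
  exists M, forall x, A x -> `|u x| <= M.
Proof.
move=> cA cu; have /compact_bounded[M [_ hM]] : compact (u @` A).
  by apply: continuous_compact => //; exact: continuous_in_subspaceT.
by exists (M + 1) => x Ax; apply: (hM _ (ltr_pwDr ltr01 (lexx M))); exists x.
Qed.

(** Turns closeness measured by the cosine into distance modulo the period, as cosine strictly
    decreases on [[0, pi]]. *)
Lemma cos_sub_gt x s d : cycle x -> cycle s -> 0 < d <= pi ->
  cos d < cos (x - s) -> exists k : int, `|x - (s + k%:~R * (pi *+ 2))| < d.
Proof.
rewrite /= !in_itv /= => /andP[x1 x2] /andP[s1 s2] /andP[d0 dpi].
rewrite -[cos (x - s)]cos_norm => cd.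
have lt_d t : 0 <= t <= pi -> cos d < cos t -> t < d.
  by move=> tI; rewrite ltr_cos ?in_itv//= (ltW d0) dpi.
have [xs|xs] := leP `|x - s| pi.
  by exists 0; rewrite mul0r addr0; apply: lt_d; rewrite ?normr_ge0.
have {}cd : cos d < cos (pi *+ 2 - `|x - s|).
  by rewrite -[ltRHS]cosN opprB -[ltRHS]cosD2pi subrK.
(* Now [|x - s|] lies between [pi] and [2 pi]: moving [s] one period towards [x] leaves the distance
   [2 pi - |x - s|], which is at most [pi]. *)
exists (if s <= x then 1 else -1).
have -> : `|x - (s + (if s <= x then 1 else -1)%:~R * (pi *+ 2))| =
    pi *+ 2 - `|x - s|.
  move: xs; case: (leP s x) => sx xs.
    rewrite ger0_norm ?subr_ge0// in xs *; rewrite ler0_norm mulr2n; lra.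
  rewrite ltr0_norm ?subr_lt0// in xs *; rewrite ger0_norm mulr2n; lra.
apply: lt_d => //; apply/andP; split; last by rewrite mulr2n; lra.
rewrite subr_ge0 mulr2n ler_norml; apply/andP; split; lra.
Qed.

(** The constants [M], [d] and [J] are fixed before [x], so one [n] serves all of [A]. *)
Lemma real_fejer_mean_cvg_uniform A u e : compact A -> A `<=` cycle ->
  mu.-integrable cycle (EFin \o u) ->
  (forall s (k : int), u (s + k%:~R * (pi *+ 2)) = u s) ->
  {in A, continuous u} -> 0 < e ->
  \forall n \near \oo, forall x, A x -> `|real_fejer_mean u n x - u x| < e.
Proof.
move=> cA Acycle iu pu cu e0.
have [M uM] := compact_continuous_bounded cA cu.
have [d0 d0_gt0 hd0] := compact_uniform_modulus cA cu (divr_gt0 e0 (ltr0Sn _ 1)).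
(* The cap at [pi] keeps [d] where cosine decreases, as [cos_sub_gt] requires. *)
pose d := Num.min d0 pi.
have dI : 0 < d <= pi by rewrite lt_min d0_gt0 pi_gt0 ge_min lexx orbT.
have c0 : 0 < 1 - cos d.
  rewrite subr_gt0 -cos0 ltr_cos ?in_itv//=; case/andP: dI => //.
  - by rewrite lexx pi_ge0.
  - by move=> /ltW-> ->.
pose J := (pi *+ 2)^-1 * \int[mu]_(s in cycle) `|u s| + M.
have lim : J * (2 / (1 - cos d)) * harmonic n @[n --> \oo] --> (0 : R).
  rewrite -[X in _ --> X](mulr0 (J * (2 / (1 - cos d)))).
  by apply: cvgM; [exact: cvg_cst|exact: cvg_harmonic].
near=> n => x Ax.
apply: le_lt_trans (_ : e / 2 + J * (2 / ((1 - cos d) * n.+1%:R)) < e).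
  apply: real_fejer_mean_le => //; [exact: uM|by rewrite ltW ?divr_gt0|].
  move=> s /set_mem scycle; rewrite ltrD2l ltrN2.
  case/(cos_sub_gt (Acycle _ Ax) scycle dI) => k hk.
  (* By periodicity [s] is replaced by its translate close to [x], which may lie outside the
     cycle. *)
  rewrite -(pu s k) ltW//; apply: hd0 => //.
  by apply: (lt_le_trans hk); rewrite ge_min lexx.
rewrite [ltRHS](splitr e) ltrD2l invfM mulrA mulrA -[X in X * _]mulrA.
by near: n; apply: (cvgr_lt _ lim); rewrite divr_gt0.
Unshelve. all: by end_near.
Qed.

End Real_fejer_mean.

(** * Complex Fejer means as convolutions *)

Section Complex_fejer_mean.
Context {R : realType}.
Set Implicit Arguments.
Unset Strict Implicit.
Unset Printing Implicit Defensive.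
Local Open Scope complex_scope.
Local Open Scope quotient_scope.
Local Notation mu := (@completed_lebesgue_measure R).
Local Notation cycle := (`[- pi, pi]%classic : set R).
Local Notation Re := complex.Re.
Local Notation Im := complex.Im.
Implicit Types (f : circle R -> R[i]^o) (g h : R -> R[i]) (n : nat).

Lemma ReM (z w : R[i]) : Re (z * w) = Re z * Re w - Im z * Im w.
Proof. by case: z w => [a b] [c d]. Qed.

Lemma ImM (z w : R[i]) : Im (z * w) = Re z * Im w + Im z * Re w.
Proof. by case: z w => [a b] [c d]. Qed.

Lemma expiD (s t : R) : expi (s + t) = expi s * expi t.
Proof.
by apply/eqP; rewrite eq_complex ReM ImM /= cosD sinD !eqxx addrC eqxx.
Qed.

Lemma cintegrableM g h : continuous (fun s => Re (h s)) ->
  continuous (fun s => Im (h s)) -> cintegrable g ->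
  cintegrable (fun s => g s * h s).
Proof.
move=> cr ci [gr gi].
have mI := @measurable_cycle R.
split.
  rewrite (_ : (fun s => _) =
    EFin \o (fun s => Re (g s) * Re (h s) - Im (g s) * Im (h s))).
    by apply: integrable_EFinB => //; apply: integrable_mul_continuous.
  by apply/funext => s /=; rewrite ReM.
rewrite (_ : (fun s => _) =
  EFin \o (fun s => Re (g s) * Im (h s) + Im (g s) * Re (h s))).
  by apply: integrable_EFinD => //; apply: integrable_mul_continuous.
by apply/funext => s /=; rewrite ImM.
Qed.

Lemma cintegralZr g (z : R[i]) : cintegrable g ->
  cintegral (fun s => g s * z) = cintegral g * z.
Proof.
move=> [gr gi]; have mI := @measurable_cycle R.
have iZ (r : R) k : mu.-integrable cycle (EFin \o k) ->
    mu.-integrable cycle (EFin \o (fun s => k s * r)).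
  by move=> ih; apply: integrable_mul_continuous => // s; exact: cvg_cst.
apply/eqP; rewrite eq_complex ReM ImM /=.
under eq_Rintegral do rewrite ReM.
under [X in _ && (X == _)]eq_Rintegral do rewrite ImM.
rewrite RintegralB ?RintegralD//; try exact: iZ.
by rewrite !RintegralZr// !eqxx.
Qed.

Lemma cintegral_sum (I : Type) (s : seq I) (g : I -> R -> R[i]) :
  (forall i, cintegrable (g i)) ->
  cintegral (fun x => \sum_(i <- s) g i x) = \sum_(i <- s) cintegral (g i).
Proof.
move=> ig; have mI := @measurable_cycle R.
apply/eqP; rewrite eq_complex /= !raddf_sum /=.
under eq_Rintegral do rewrite raddf_sum.
under [X in _ && (X == _)]eq_Rintegral do rewrite raddf_sum.
by rewrite !Rintegral_sum ?eqxx// => i; case: (ig i).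
Qed.

Lemma cintegrable_cst g (z : R[i]) :
  cintegrable g -> cintegrable (fun s => g s * z).
Proof. by apply: (cintegrableM (h := cst z)) => s; exact: cvg_cst. Qed.

Lemma cintegrable_real g (k : R -> R) : continuous k ->
  cintegrable g -> cintegrable (fun s => g s * (k s)%:C).
Proof.
move=> ck; apply: (cintegrableM (h := fun s => (k s)%:C)) => //= s.
exact: cvg_cst.
Qed.

Lemma cintegrable_expi g (k x : R) :
  cintegrable g -> cintegrable (fun s => g s * expi (k * (x - s))).
Proof.
apply: cintegrableM => /=; first exact: continuous_cos_affine.
move=> s; apply: continuous_comp; last exact: continuous_sin.
by apply: cvgM; [exact: cvg_cst|apply: cvgB; [exact: cvg_cst|exact: cvg_id]].
Qed.

Lemma sum_expi n (t : R) :
  \sum_(j < n.*2.+1) expi ((j%:Z - n%:Z)%:~R * t) = (dirichlet_kernel n t)%:C.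
Proof.
apply/eqP; rewrite eq_complex !raddf_sum /= eqxx /=; apply/eqP.
by rewrite big1_eq; exact: sum_sin_eq0.
Qed.

(** The factors [e^{-iks}] and [e^{ikx}] merge into [e^{ik(x-s)}], and the finite sum moves under
    the integral. *)
Lemma fourier_sumE f n (x : R) : L1 f ->
  fourier_sum f n (\pi_(circle R) x) = ((pi *+ 2)^-1)%:C *
    cintegral (fun s => f (\pi s) * (dirichlet_kernel n (x - s))%:C).
Proof.
move=> fL1; rewrite /fourier_sum.
have iM (k : int) : cintegrable (fun s => f (\pi s) * expi (- (k%:~R * s))).
  rewrite (_ : (fun s => _) = (fun s => f (\pi s) * expi (k%:~R * (0 - s)))).
    exact: cintegrable_expi.
  by apply/funext => s; rewrite sub0r mulrN.
under eq_bigr => j _.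
  rewrite /fourier_coef echarE -mulrA -cintegralZr//.
  over.
rewrite -mulr_sumr -cintegral_sum => [|j]; last exact: cintegrable_cst.
congr (_ * cintegral _); apply/funext => s.
rewrite -sum_expi mulr_sumr; apply: eq_bigr => j _.
by rewrite -mulrA -expiD mulrBr addrC.
Qed.

(** The kernel is real, so the convolution acts separately on real and imaginary parts. *)
Lemma fejer_meanE f n (x : R) : L1 f ->
  fejer_mean f n (\pi_(circle R) x) =
  real_fejer_mean (fun s => Re (f (\pi s))) n x +i*
  real_fejer_mean (fun s => Im (f (\pi s))) n x.
Proof.
move=> fL1; rewrite /fejer_mean; under eq_bigr do rewrite fourier_sumE//.
have iD (m : nat) :
    cintegrable (fun s => f (\pi s) * (dirichlet_kernel m (x - s))%:C).
  exact/(cintegrable_real _ fL1)/continuous_comp_subl/continuous_dirichlet_kernel.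
rewrite -mulr_sumr -cintegral_sum// -mulrA -cintegralZr; last first.
  rewrite (_ : (fun s => _) = (fun s => f (\pi s) *
      (\sum_(m < n.+1) dirichlet_kernel m (x - s))%:C)).
    apply/(cintegrable_real _ fL1) => s.
    apply: cvg_big => [|m _]; first exact: add_continuous.
    exact/continuous_comp_subl/continuous_dirichlet_kernel.
  by apply/funext => s; rewrite -mulr_sumr raddf_sum.
rewrite (_ : (fun s => _) =
    (fun s => f (\pi s) * (fejer_kernel n (x - s))%:C)); last first.
  apply/funext => s; rewrite -mulr_sumr /fejer_kernel rmorphM raddf_sum.
  by rewrite -mulrA rmorphV ?unitfE ?pnatr_eq0// rmorph_nat.
apply/eqP; rewrite eq_complex ReM ImM /= !mul0r subr0 addr0.
by apply/andP; split; apply/eqP; congr (_ * _); apply: eq_Rintegral => s _;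
  rewrite ?ReM ?ImM /= mulr0 ?subr0 ?add0r.
Qed.

End Complex_fejer_mean.

(** * Topology of the complex plane and representatives of circle points *)

Section Complex_topology.
Context {R : realType}.
Set Implicit Arguments.
Unset Strict Implicit.
Unset Printing Implicit Defensive.
Local Open Scope complex_scope.
Local Open Scope quotient_scope.
Implicit Types (z w : R[i]^o).

(** The modulus is valued in [R[i]], hence the cast of the real side. *)
Lemma normc_ge_Im (z : R[i]) : `|complex.Im z|%:C <= `|z|.
Proof.
by rewrite normc_def lecR -sqrtr_sqr ler_wsqrtr// lerDr sqr_ge0.
Qed.

Lemma normc_le_ReIm (z : R[i]) :
  `|z| <= (`|complex.Re z| + `|complex.Im z|)%:C.
Proof.
rewrite normc_def lecR -[leRHS]ger0_norm ?addr_ge0// -sqrtr_sqr.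
rewrite ler_wsqrtr// sqrrD !real_normK ?num_real// lerD2r lerDl.
by rewrite mulrn_wge0 ?mulr_ge0.
Qed.

Lemma continuous_Re : continuous (@complex.Re R : R[i]^o -> R).
Proof.
move=> z; apply/(@cvgrPdist_lt _ _ _ _ (nbhs_filter z)) => e e0.
have e0C : 0 < e%:C :> R[i] by rewrite ltcR.
exists e%:C => //= w zw.
rewrite -ltcR -raddfB; apply: le_lt_trans zw; exact: normc_ge_Re.
Qed.

Lemma continuous_Im : continuous (@complex.Im R : R[i]^o -> R).
Proof.
move=> z; apply/(@cvgrPdist_lt _ _ _ _ (nbhs_filter z)) => e e0.
have e0C : 0 < e%:C :> R[i] by rewrite ltcR.
exists e%:C => //= w zw.
rewrite -ltcR -raddfB; apply: le_lt_trans zw; exact: normc_ge_Im.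
Qed.

Lemma entourage_complexP (E : set (R[i]^o * R[i]^o)) : entourage E ->
  exists2 e : R, 0 < e & forall z w,
    `|complex.Re (w - z)| < e -> `|complex.Im (w - z)| < e -> E (z, w).
Proof.
(* A positive radius in [R[i]] has imaginary part 0; half of its real part is allotted to each
   coordinate. *)
rewrite -entourage_ballE => -[[a b] /=]; rewrite ltcE /= => /andP[/eqP-> a0] aE.
exists (a / 2) => [|z w re im]; first by rewrite divr_gt0.
apply: aE => /=; rewrite -ball_normE /= distrC.
apply: (le_lt_trans (normc_le_ReIm _)).
by rewrite ltcR [ltRHS]splitr ltrD.
Qed.

Lemma continuous_pi_circle : continuous (fun t : R => \pi_(circle R) t).
Proof. exact: pi_continuous. Qed.

Lemma circle_repr (x : circle R) :
  exists2 t : R, `[- pi, pi]%classic t & x = \pi_(circle R) t.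
Proof.
(* Subtracting this many periods brings [repr x] into [[-pi, pi)]. *)
pose k := Num.floor ((repr x + pi) / (pi *+ 2)).
have p0 : 0 < (pi *+ 2 : R) by rewrite mulrn_wgt0 ?pi_gt0.
exists (repr x - k%:~R * (pi *+ 2)).
  have := floor_le ((repr x + pi) / (pi *+ 2)).
  have := floorD1_gt ((repr x + pi) / (pi *+ 2)).
  rewrite -/k ler_pdivlMr// ltr_pdivrMr// intrD mulrDl mul1r mulr2n => h1 h2.
  by rewrite /= in_itv /=; apply/andP; split; lra.
rewrite -[LHS]reprK; apply/circle_eqP; exists k.
by rewrite opprB addrC subrK.
Qed.

End Complex_topology.

(** * Passage from the line to the circle *)

Theorem theorem6p1 (R : realType) (f : circle R -> R[i]^o) (K : set (circle R)) :
  L1 f -> closed K -> K `<=` continuity_points f ->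
  {uniform K, fejer_mean f @ \oo --> f}.
Proof.
move=> fL1 Kclosed Kcont; have [fRe fIm] := fL1.
pose g (t : R) : R[i]^o := f (\pi_(circle R)%qT t).
(* The lift of [K] to one period is closed in a compact segment, hence compact. *)
pose A : set R := `[- pi, pi]%classic `&` [set t | K (\pi_(circle R)%qT t)].
have Acycle : A `<=` `[- pi, pi]%classic by move=> t [].
have Acompact : compact A.
  apply: (subclosed_compact _ (@segment_compact R (- pi) pi)) => //.
  apply: closedI; first exact: itv_closed.
  by apply: preimage_closed => // t _; exact: continuous_pi_circle.
have gcont t : A t -> {for t, continuous g}.
  by move=> [_ /Kcont fc]; apply: continuous_comp => //; exact: continuous_pi_circle.
have Recont : {in A, continuous (@complex.Re R \o g)}.
  move=> t /set_mem At; apply: continuous_comp; first exact: gcont.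
  exact: continuous_Re.
have Imcont : {in A, continuous (@complex.Im R \o g)}.
  move=> t /set_mem At; apply: continuous_comp; first exact: gcont.
  exact: continuous_Im.
have gper t (k : int) : g (t + k%:~R * (pi *+ 2)) = g t.
  by congr f; apply/circle_eqP; exists k; rewrite addrC addKr.
(* A uniform neighbourhood of [f] on [K] reduces to one real [e] bounding both coordinates. *)
move=> P /uniform_nbhs [E [/entourage_complexP[e e0 eE] EP]].
have Recvg := real_fejer_mean_cvg_uniform Acompact Acycle fRe
  (fun t k => congr1 (@complex.Re R) (gper t k)) Recont e0.
have Imcvg := real_fejer_mean_cvg_uniform Acompact Acycle fIm
  (fun t k => congr1 (@complex.Im R) (gper t k)) Imcont e0.
(* The filter of the goal lives on functions; [near] must range over [n]. *)
change (\forall n \near \oo, P (fejer_mean f n)).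
near=> n; apply: EP => x Kx /=; have [t tI xt] := circle_repr x.
have At : A t by split => //=; rewrite -xt.
rewrite xt fejer_meanE//; apply: eE; rewrite raddfB /=.
  by apply: (near Recvg n).
by apply: (near Imcvg n).
Unshelve. all: by end_near.
Qed.
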